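(* The following are equivalent. (i) $C$ is Klee with respect to the left Bregman distance, i.e., $\overleftarrow{Q}_C$ is single-valued on $U$. (ii) $\overleftarrow{Q}_C$ is single-valued and continuous on $U$. (iii) $\overleftarrow{F}_C\circ\nabla f^*$ is continuously differentiable on $\mathbb{R}^J$. (iv) $-f^\vee+\iota_{-C}$ is convex. (v) $C$ is a singleton. If (i)--(v) hold, then $\nabla(\overleftarrow{F}_C\circ\nabla f^* )=\nabla f^*-\overleftarrow{Q}_C\circ\nabla f^*$. If $f$ is twice continuously differentiable on $U$ and the Hessian $\nabla^2 f(y)$ is positive definite for every $y\in U$, then (i)--(v) are also equivalent to (vi) $\overleftarrow{F}_C$ is differentiable on $U$, in which case $\overleftarrow{F}_C$ is actually continuously differentiable on $U$ with $$(\forall y\in U)\quad \nabla\overleftarrow{F}_C(y)=\nabla^2 f(y)\big(y-\overleftarrow{Q}_C(y)\big).$$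
   Context: $\mathbb{R}^J$ is the standard Euclidean space with inner product $\langle\cdot,\cdot\rangle$ and norm $\|\cdot\|$. Standing assumptions: (1) $f\colon\mathbb{R}^J\to\,]-\infty,+\infty]$ is a convex function of Legendre type, i.e., $f$ is proper, lower semicontinuous, convex, essentially smooth (with $U:=\operatorname{int}\operatorname{dom} f\neq\varnothing$, $f$ is differentiable on $U$ and $\|\nabla f(x_n)\|\to+\infty$ whenever $(x_n)$ is a sequence in $U$ converging to a boundary point of $U$) and essentially strictly convex ($f$ is strictly convex on every convex subset of $\operatorname{dom}\partial f$). (2) $f$ is $1$-coercive: $\lim_{\|x\|\to+\infty} f(x)/\|x\|=+\infty$ (equivalently, $\operatorname{dom} f^*=\mathbb{R}^J$). (3) $C$ is a nonempty bounded closed (hence compact) subset of $U$. Here $f^*$ is the Fenchel conjugate; under these assumptions $\nabla f\colon U\to\mathbb{R}^J$ and $\nabla f^*\colon\mathbb{R}^J\to U$ are continuous bijections, inverse to each other. The Bregman distance is $D(x,y)=f(x)-f(y)-\langle\nabla f(y),x-y\rangle$ if $y\in U$, and $D(x,y)=+\infty$ otherwise. For $y\in U$: $\overleftarrow{F}_C(y)=\sup_{x\in C}D(x,y)$ (left Bregman farthest-distance function) and $\overleftarrow{Q}_C(y)=\operatorname{argmax}_{x\in C}D(x,y)$ (left Bregman farthest-point map, set-valued); when $\overleftarrow{Q}_C(y)$ is a singleton it is identified with its element. The function $-f^\vee+\iota_{-C}\colon\mathbb{R}^J\to\,]-\infty,+\infty]$ takes the value $-f(-x)$ if $x\in -C$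 and $+\infty$ otherwise. *)

(* Defs.v *)
From HB Require Import structures.
From mathcomp Require Import all_boot all_order all_algebra.
From mathcomp Require Import all_classical all_reals all_analysis.

Set Implicit Arguments.
Unset Strict Implicit.
Unset Printing Implicit Defensive.

Import Order.TTheory GRing.Theory Num.Theory.
Import numFieldNormedType.Exports.

Local Open Scope classical_set_scope.
Local Open Scope ring_scope.

(* R^J is 'rV[R]_J. The library norm `|_| on 'rV[R]_J is the sup norm: it gives
   the Euclidean topology, bounded sets and Frechet derivatives, while the
   Euclidean structure proper is given by dot and enorm. *)

Section Euclidean.
Context {R : realType} {J : nat}.
Implicit Types (u v x y s : 'rV[R]_J) (A : set 'rV[R]_J).

Definition dot u v : R := \sum_(i < J) u 0 i * v 0 i.

Definition enorm u : R := Num.sqrt (dot u u).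

(* The vector representing 'd F x in the inner product dot, see dot_grad. *)
Definition grad (F : 'rV[R]_J -> R) x : 'rV[R]_J :=
  \row_(i < J) 'd F x (delta_mx 0 i).

Lemma dot_grad (F : 'rV[R]_J -> R) x v :
  dot (grad F x) v = 'd F x v.
Proof.
rewrite [in RHS](row_sum_delta v) linear_sum /dot.
by apply: eq_bigr => i _; rewrite mxE linearZ /= mulrC.
Qed.

(* 'J acts on row vectors from the right, so v *m hessian F x is the derivative
   of grad F at x in the direction v. *)
Definition hessian (F : 'rV[R]_J -> R) x : 'M[R]_J := 'J (grad F) x.

(* The two notions below are used with A open only. *)
Definition continuously_differentiable_on A (F : 'rV[R]_J -> R) : Prop :=
  {in A, forall x, differentiable F x} /\ {within A, continuous (grad F)}.

Definition twice_continuously_differentiable_on A (F : 'rV[R]_J -> R) : Prop :=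
  [/\ {in A, forall x, differentiable F x},
      {in A, forall x, differentiable (grad F) x} &
      {within A, continuous (hessian F)}].

(* Symmetry is not required: the Hessian of a C^2 function is symmetric. *)
Definition positive_definite (H : 'M[R]_J) : Prop :=
  forall v, v != 0 -> 0 < dot (v *m H) v.

End Euclidean.

Section ConvexAnalysis.
Context {R : realType} {J : nat}.
Implicit Types (f : 'rV[R]_J -> \bar R) (x y s : 'rV[R]_J).
Local Open Scope ereal_scope.

Definition edom f : set 'rV[R]_J := [set x | f x < +oo].

Definition proper_fun f : Prop := (forall x, -oo < f x) /\ edom f !=set0.

(* Used only for f with values in ]-oo, +oo], where no sum +oo - oo arises. *)
Definition econvex f : Prop := forall x y (t : R), (0 < t < 1)%R ->
  f (t *: x + (1 - t) *: y)%R <= t%:E * f x + (1 - t)%:E * f y.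

Definition subdiff f x : set 'rV[R]_J :=
  [set s | forall y, f x + (dot s (y - x)%R)%:E <= f y].

Definition dom_subdiff f : set 'rV[R]_J := [set x | subdiff f x !=set0].

Definition int_dom f : set 'rV[R]_J := (edom f)°.

(* f is finite on int_dom f when f is proper. *)
Definition egrad f : 'rV[R]_J -> 'rV[R]_J := grad (fine \o f).

Definition essentially_smooth f : Prop :=
  [/\ int_dom f !=set0,
      {in int_dom f, forall x, differentiable (fine \o f) x} &
      forall (u : nat -> 'rV[R]_J) x, (forall n, int_dom f (u n)) ->
        (closure (int_dom f) `\` int_dom f) x -> u @ \oo --> x ->
        (fun n => enorm (egrad f (u n))) @ \oo --> +oo%R].

Definition essentially_strictly_convex f : Prop :=
  forall A : set 'rV[R]_J, convex_set A -> A `<=` dom_subdiff f ->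
  forall x y (t : R), A x -> A y -> x != y -> (0 < t < 1)%R ->
    f (t *: x + (1 - t) *: y)%R < t%:E * f x + (1 - t)%:E * f y.

Definition convex_Legendre f : Prop :=
  [/\ proper_fun f, lower_semicontinuous f, econvex f,
      essentially_smooth f & essentially_strictly_convex f].

Definition one_coercive f : Prop := forall M : R, exists r : R,
  forall x, (r < enorm x)%R -> M%:E <= f x * ((enorm x)^-1)%:E.

Definition conjugate f s : \bar R :=
  ereal_sup [set (dot x s)%:E - f x | x in [set: 'rV[R]_J]].

End ConvexAnalysis.

Section LeftBregman.
Context {R : realType} {J : nat}.
Variables (f : 'rV[R]_J -> \bar R) (C : set 'rV[R]_J).
Implicit Types x y : 'rV[R]_J.
Local Open Scope ereal_scope.

Definition bregman x y : \bar R :=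
  if y \in int_dom f then f x - f y - (dot (egrad f y) (x - y)%R)%:E
  else +oo.

Definition left_farthest_dist y : \bar R :=
  ereal_sup [set bregman x y | x in C].

(* The real-valued version: left_farthest_dist is finite on int_dom f when C is
   a nonempty compact subset of int_dom f. *)
Definition left_farthest_distr y : R := fine (left_farthest_dist y).

Definition left_farthest_map y : set 'rV[R]_J :=
  [set x | C x /\ forall z, C z -> bregman z y <= bregman x y].

Definition left_Klee : Prop :=
  forall y, int_dom f y -> exists x, left_farthest_map y = [set x].

(* The element of left_farthest_map y when the latter is a singleton. *)
Definition left_farthest_pt y : 'rV[R]_J := xget 0%R (left_farthest_map y).

(* The function - f^\vee + \iota_{-C}. *)
Definition neg_reflect_on x : \bar R :=
  if x \in [set (- c)%R | c in C] then - f (- x)%R else +oo.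

End LeftBregman.

(* Main.v *)
Require Import Defs.
From HB Require Import structures.
From mathcomp Require Import all_boot all_order all_algebra.
From mathcomp Require Import ring lra.
From mathcomp Require Import all_classical all_reals all_analysis.

(* Put phi(s) = F(grad f^*(s)) and let x be a farthest point of y = grad f^*(s).
   Then y - x is a subgradient of phi at s, so phi is convex and lower
   semicontinuous; it is also coercive because C lies inside U. Hence phi attains
   its minimum at some s0. If phi is differentiable at s0, then
   0 = grad phi(s0) = y0 - x0: the minimizer y0 of F is its own farthest point,
   so F(y0) = 0 and C = {y0} by strict convexity. Single-valuedness of Q makes
   s |-> y - x continuous by compactness, whence phi is differentiable.
   For (vi), F - D(x0, .) is minimal at y0 too, so the Hessian at y0 annihilates
   y0 - x0. *)

Set Implicit Arguments.
Unset Strict Implicit.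
Unset Printing Implicit Defensive.

Import Order.TTheory GRing.Theory Num.Theory.
Import numFieldNormedType.Exports.

Local Open Scope classical_set_scope.
Local Open Scope ring_scope.

(** The function k = [neg_reflect_on f C] is what links farthest points to subgradients: x is
    farthest from y exactly when grad f(y) is a subgradient of k at -x. Thus Q composed with grad
    f^* inverts, up to sign, the subdifferential of k, just as grad f^* inverts that of f. Both f
    and k are proper, lower semicontinuous and superlinear, which yields a point with any prescribed
    subgradient and, when that point is always unique, its continuous dependence on the slope. These
    facts are proved once, for functions that may fail to be convex, since k is convex only when C
    is a singleton: a second point of C would make f both concave and strictly convex at a midpoint,
    which is (iv) to (v). Derivatives of F on U itself call for second derivatives of f, because
    D(x, .) contains grad f. *)

Lemma cvg_coord {R : realType} (T : Type) (F : set_system T) {FF : Filter F}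
    (m n : nat) (g : T -> 'M[R]_(m, n)) (A : 'M[R]_(m, n)) i j :
  g @ F --> A -> g x i j @[x --> F] --> A i j.
Proof.
move=> gA; apply: (cvg_comp g (fun M : 'M[R]_(m, n) => M i j) gA).
exact: (@coord_continuous R m n i j A).
Qed.

(** * Inner product and comparison of the Euclidean and sup norms *)

Section dot_theory.
Context {R : realType} {J : nat}.
Implicit Types (u v w : 'rV[R]_J) (a : R).

Lemma dotE u v : dot u v = (u *m v^T) 0 0.
Proof. by rewrite mxE; apply: eq_bigr => i _; rewrite mxE. Qed.

Lemma dotC u v : dot u v = dot v u.
Proof. by apply: eq_bigr => i _; rewrite mulrC. Qed.

Lemma dotDl u v w : dot (u + v) w = dot u w + dot v w.
Proof. by rewrite !dotE mulmxDl mxE. Qed.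

Lemma dotDr u v w : dot u (v + w) = dot u v + dot u w.
Proof. by rewrite dotC dotDl !(dotC _ u). Qed.

Lemma dotZl a u v : dot (a *: u) v = a * dot u v.
Proof. by rewrite !dotE -scalemxAl mxE. Qed.

Lemma dotZr a u v : dot u (a *: v) = a * dot u v.
Proof. by rewrite dotC dotZl dotC. Qed.

Lemma dotNl u v : dot (- u) v = - dot u v.
Proof. by rewrite -scaleN1r dotZl mulN1r. Qed.

Lemma dotNr u v : dot u (- v) = - dot u v.
Proof. by rewrite dotC dotNl dotC. Qed.

Lemma dotBl u v w : dot (u - v) w = dot u w - dot v w.
Proof. by rewrite dotDl dotNl. Qed.

Lemma dotBr u v w : dot u (v - w) = dot u v - dot u w.
Proof. by rewrite dotDr dotNr. Qed.

Lemma dot0l v : dot 0 v = 0.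
Proof. by rewrite -(scale0r 0) dotZl mul0r. Qed.

Lemma dot0r v : dot v 0 = 0.
Proof. by rewrite dotC dot0l. Qed.

Lemma dot_linear u : linear (dot u).
Proof. by move=> a v w; rewrite dotDr dotZr. Qed.

HB.instance Definition _ u :=
  GRing.isLinear.Build R 'rV[R]_J R *:%R (dot u) (dot_linear u).

Lemma dot_delta u i : dot u (delta_mx 0 i) = u 0 i.
Proof.
rewrite /dot (bigD1 i)//= big1 ?addr0 => [|j /negPf ji].
  by rewrite mxE !eqxx mulr1.
by rewrite mxE ji andbF mulr0.
Qed.

Lemma dot_inj u v : (forall w, dot u w = dot v w) -> u = v.
Proof. by move=> uv; apply/rowP => i; rewrite -!dot_delta uv. Qed.

Lemma ler_coord_norm u i : `|u 0 i| <= `|u|.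
Proof.
by rewrite [leRHS]mx_normrE; apply: (@le_bigmax _ _ _ 0 (fun p => `|u p.1 p.2|) (0, i)).
Qed.

Lemma normr_dot_le u v : `|dot u v| <= J%:R * `|u| * `|v|.
Proof.
rewrite (le_trans (ler_norm_sum _ _ _))//.
rewrite -[leRHS]mulrA mulr_natl -[X in _ *+ X](card_ord J) -sumr_const.
by apply: ler_sum => i _; rewrite normrM ler_pM// ler_coord_norm.
Qed.

Lemma dot_self_ge0 u : 0 <= dot u u.
Proof. by apply: sumr_ge0 => i _; rewrite -expr2 sqr_ge0. Qed.

Lemma enorm_ge0 u : 0 <= enorm u.
Proof. exact: sqrtr_ge0. Qed.

Lemma sqr_enorm u : enorm u ^+ 2 = dot u u.
Proof. by rewrite sqr_sqrtr// dot_self_ge0. Qed.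

Lemma norm_le_enorm u : `|u| <= enorm u.
Proof.
rewrite [leLHS]mx_normrE; apply: bigmax_le; first exact: enorm_ge0.
move=> [i j] _ /=; rewrite ord1 -sqrtr_sqr ler_sqrt ?dot_self_ge0//.
rewrite /dot (bigD1 j)//= expr2 lerDl.
by apply: sumr_ge0 => k _; rewrite -expr2 sqr_ge0.
Qed.

(** The Euclidean maximiser lies in the sup-norm ball by [norm_le_enorm], so bounds over such a ball
    control [enorm]. For [u = 0] the convention [r / 0 = 0] gives [v = 0]. *)
Lemma dot_ball_attained u (r : R) : 0 <= r ->
  exists2 v, `|v| <= r & dot u v = r * enorm u.
Proof.
move=> r0; set e := enorm u; exists ((r / e) *: u).
  rewrite normrZ ger0_norm ?divr_ge0 ?enorm_ge0//.
  have [->|eN0] := eqVneq e 0; first by rewrite invr0 mulr0 mul0r.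
  have e0 : 0 < e by rewrite lt_neqAle eq_sym eN0 enorm_ge0.
  by rewrite mulrAC ler_pdivrMr// ler_wpM2l//; exact: norm_le_enorm.
rewrite dotZr -sqr_enorm -/e; have [->|eN0] := eqVneq e 0; last by field.
by rewrite expr0n/= !mulr0.
Qed.

Lemma cvg_dot (T : Type) (F : set_system T) {FF : Filter F}
    (g h : T -> 'rV[R]_J) u v :
  g @ F --> u -> h @ F --> v -> dot (g x) (h x) @[x --> F] --> dot u v.
Proof.
move=> gu hv; apply: cvg_big => [|i _]; first exact: add_continuous.
by apply: cvgM; exact: cvg_coord.
Qed.

Lemma continuous_dot u : continuous (dot u).
Proof. by move=> v; apply: (@cvg_dot _ (nbhs v) _ (cst u) id) => //; exact: cvg_cst. Qed.

Lemma continuous_dotBr u v : continuous (fun w => dot u (v - w)).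
Proof.
move=> w; apply: (@cvg_dot _ (nbhs w) _ (cst u) (fun x => v - x)); first exact: cvg_cst.
by apply: (@cvgB _ _ _ (nbhs w) _ (cst v) id); [exact: cvg_cst|exact: cvg_id].
Qed.

Lemma continuous_dotB2 v :
  continuous (fun p : 'rV[R]_J * 'rV[R]_J => dot p.1 (v - p.2)).
Proof.
move=> p; apply: (@cvg_dot _ (nbhs p) _ fst (fun p => v - p.2)); first exact: cvg_fst.
by apply: (@cvgB _ _ _ (nbhs p) _ (cst v) snd); [exact: cvg_cst|exact: cvg_snd].
Qed.

End dot_theory.

(** * Gradients, subgradients and minimisers *)

Section gradient.
Context {R : realType} {J : nat}.
Implicit Types (g : 'rV[R]_J -> R) (s u v x y : 'rV[R]_J).

Lemma diff_ge g x v (a : R) : differentiable g x ->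
  (\forall t \near 0^'+, g x + t * a <= g (t *: v + x)) -> a <= 'd g x v.
Proof.
move=> dg ga.
have gc : h^-1 *: (g (h *: v + x) - g x) @[h --> 0^'+] --> 'd g x v.
  by rewrite -(deriveE v dg); apply: cvg_dnbhs_at_right; exact: diff_derivable dg.
rewrite -(cvg_lim (@Rhausdorff R) gc); apply: limr_ge; first by apply/cvg_ex; eexists; exact: gc.
near=> t; have t0 : 0 < t by [].
by rewrite /= /GRing.scale/= ler_pdivlMl// lerBrDl; near: t.
Unshelve. all: by end_near. Qed.

Lemma diff_opp g x v : differentiable g x -> 'd (\- g) x v = - 'd g x v.
Proof. by move=> dg; rewrite (diffN dg). Qed.

Lemma diff_le g x v (a : R) : differentiable g x ->
  (\forall t \near 0^'+, g (t *: v + x) <= g x + t * a) -> 'd g x v <= a.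
Proof.
move=> dg ga; rewrite -lerN2 -diff_opp//.
apply: diff_ge; first exact: differentiableN.
by apply: filterS ga => t /=; rewrite mulrN -opprD lerN2.
Qed.

Lemma near_line (P : set 'rV[R]_J) x v :
  (\near x, P x) -> \forall t \near 0^'+, P (t *: v + x).
Proof.
move=> Px.
suff : t *: v + x @[t --> (0 : R)^'+] --> x by apply.
apply: cvg_at_right_filter; rewrite -[X in _ --> X]add0r -(scale0r v).
by apply: cvgD; [apply: cvgZr_tmp|exact: cvg_cst].
Qed.

Lemma near_shift0 (P : set 'rV[R]_J) x :
  (\near x, P x) -> \forall h \near (0 : 'rV[R]_J), P (h + x).
Proof.
have hx : h + x @[h --> (0 : 'rV[R]_J)] --> x.
  by rewrite -{2}(add0r x); exact: cvgD cvg_id (cvg_cst _).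
exact: hx.
Qed.

(* One subgradient bound suffices: it applies to both directions v and - v. *)
Lemma grad_subgradient g x s : differentiable g x ->
  (\forall y \near x, g x + dot s (y - x) <= g y) -> grad g x = s.
Proof.
move=> dg gs; apply: dot_inj => v.
have ds w : dot s w <= 'd g x w.
  apply: diff_ge => //; have := near_line w gs.
  by apply: filterS => t; rewrite addrK dotZr.
rewrite dot_grad; apply/eqP; rewrite eq_le ds andbT.
by have := ds (- v); rewrite dotNr linearN lerN2.
Qed.

Lemma grad_min g x : differentiable g x -> (\forall y \near x, g x <= g y) ->
  grad g x = 0.
Proof.
move=> dg gx; apply: grad_subgradient => //.
by apply: filterS gx => y; rewrite dot0l addr0.
Qed.

Lemma grad_epsilon g x s :
  (forall e : R, 0 < e ->
    \forall h \near (0 : 'rV[R]_J), `|g (h + x) - (g x + dot s h)| <= e * `|h|) ->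
  differentiable g x /\ grad g x = s.
Proof.
move=> gs; have cs := @continuous_dot R J s.
have dE : 'd g x = dot s :> (_ -> _) by apply: diff_unique => //; apply/eqaddoP.
split; first by apply/diff_locallyP; rewrite dE; split => //; apply/eqaddoP.
by apply: dot_inj => v; rewrite dot_grad dE.
Qed.

(* If X selects subgradients of g and is continuous at s, then
   0 <= g t - g s - <X s, t - s> <= <X t - X s, t - s> = o(|t - s|). *)
Lemma grad_selection g (X : 'rV[R]_J -> 'rV[R]_J) s :
  (forall t t', g t + dot (X t) (t' - t) <= g t') ->
  {for s, continuous X} -> differentiable g s /\ grad g s = X s.
Proof.
move=> gX Xs; apply: grad_epsilon => e e0.
have e1 : 0 < e / (J%:R + 1) by rewrite divr_gt0// ltr_wpDl.
have : \forall h \near (0 : 'rV[R]_J), `|X s - X (h + s)| < e / (J%:R + 1).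
  apply: (@near_shift0 (fun y => `|X s - X y| < e / (J%:R + 1))).
  by have /cvgr_dist_lt := Xs; apply.
apply: filterS => h /ltW hX.
have l1 := gX s (h + s); have l2 := gX (h + s) s.
rewrite addrK in l1.
rewrite (_ : s - (h + s) = - h) ?dotNr in l2; last by rewrite opprD addrCA subrr addr0.
rewrite ger0_norm; last by rewrite opprD addrA; lra.
rewrite (@le_trans _ _ (- dot (X s - X (h + s)) h))//.
  by rewrite dotBl; lra.
rewrite (le_trans (ler_norm _))// normrN (le_trans (normr_dot_le _ _))//.
rewrite ler_wpM2r// (@le_trans _ _ (J%:R * (e / (J%:R + 1))))//.
  by rewrite ler_wpM2l.
by rewrite mulrA ler_pdivrMr ?ltr_wpDl// mulrDr mulr1 [J%:R * e]mulrC lerDl ltW.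
Qed.

End gradient.

(** * Lower semicontinuity and attained minima *)

Section lower_semicontinuity.
Context {R : realType}.
Local Open Scope ereal_scope.

Lemma lte_dense (x y : \bar R) : x < y -> exists a : R, x < a%:E < y.
Proof.
move: x y => [x| |] [y| |]//=.
- rewrite lte_fin => xy; exists ((x + y) / 2)%R.
  by rewrite !lte_fin; apply/andP; split; lra.
- by move=> _; exists (x + 1)%R; rewrite lte_fin ltrDl ltr01 ltry.
- by move=> _; exists (y - 1)%R; rewrite lte_fin gtrDl oppr_lt0 ltr01 ltNyr.
- by move=> _; exists 0%R; rewrite ltNyr ltry.
Qed.

Lemma lsc_near (T : topologicalType) (k : T -> \bar R) x (a : R) :
  lower_semicontinuous k -> a%:E < k x -> \forall y \near x, a%:E < k y.
Proof. by move=> lk /lk[V Vx kV]; apply: filterS Vx. Qed.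

Lemma lsc_addr (T : topologicalType) (k : T -> \bar R) (c : T -> R) :
  lower_semicontinuous k -> continuous c ->
  lower_semicontinuous (fun x => k x + (c x)%:E).
Proof.
move=> lk cc x a ax.
have : (a - c x)%:E < k x by rewrite EFinB lteBlDr.
move=> /lte_dense[b /andP[]]; rewrite lte_fin => ab bk.
exists [set y | b%:E < k y /\ (a - b < c y)%R] => [|y /= [by_ ac]].
  apply: filterI; first exact: lsc_near.
  by apply: (cvgr_gt (c x)); [exact: cc|lra].
have -> : a = (b + (a - b))%R by lra.
by rewrite EFinD lteD// lte_fin.
Qed.

(** Sublevel sets at values taken on [K] are nested, hence a filter base; compactness gives a
    cluster point, and lower semicontinuity puts it in each of them. *)
Lemma lsc_compact_min (T : topologicalType) (k : T -> \bar R) (K : set T) :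
  lower_semicontinuous k -> compact K -> K !=set0 ->
  exists2 x, K x & forall y, K y -> k x <= k y.
Proof.
move=> lk cK [x0 Kx0].
pose B y := [set x | K x /\ k x <= k y].
have FF : Filter (filter_from K B).
  apply: filter_from_filter; first by exists x0.
  move=> i j Ki Kj; have [ij|/ltW ji] := leP (k i) (k j).
    by exists i => // x [Kx xi]; split; split => //; exact: le_trans ij.
  by exists j => // x [Kx xi]; split; split => //; exact: le_trans ji.
have PF : ProperFilter (filter_from K B).
  by apply: filter_from_proper => y Ky; exists y; split.
have [|z [Kz cz]] := cK _ PF; first by exists x0 => // x [].
exists z => // y Ky; rewrite leNgt; apply/negP => /lte_dense[a /andP[ya az]].
have FB : filter_from K B (B y) by exists y.
have [x [[_ xy] ax]] := cz _ _ FB (lsc_near lk az).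
by have := lt_trans (le_lt_trans xy ya) ax; rewrite ltxx.
Qed.

End lower_semicontinuity.

(** * Prescribed subgradients and the conjugate of a superlinear function *)

Section conjugation.
Context {R : realType} {J : nat}.
Implicit Types (k : 'rV[R]_J -> \bar R) (s t x y z : 'rV[R]_J).
Local Open Scope ereal_scope.

Lemma compact_norm_le (r : R) : compact [set x : 'rV[R]_J | (`|x| <= r)%R].
Proof.
apply: bounded_closed_compact.
  by exists r; split; [exact: num_real|move=> M rM x /= xr; exact: le_trans xr (ltW rM)].
apply: (@closed_comp _ _ (fun x : 'rV[R]_J => `|x|%R) [set a | (a <= r)%R]).
  by move=> x _; exact: norm_continuous.
exact: closed_le.
Qed.

Lemma lsc_min k x0 (r : R) : lower_semicontinuous k ->
  (forall x, (r < `|x|)%R -> k x0 < k x) -> exists x, forall y, k x <= k y.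
Proof.
move=> lk far.
have x0r : (`|x0| <= r)%R by rewrite leNgt; apply/negP => /far; rewrite ltxx.
have [|x xr xmin] := lsc_compact_min lk (@compact_norm_le r); first by exists x0.
exists x => y; have [yr|/far yx0] := leP `|y|%R r; first exact: xmin.
by rewrite (le_trans (xmin _ x0r))// ltW.
Qed.

Lemma lsc_subgradient (g : 'rV[R]_J -> R) :
  (forall s, exists p, forall t, (g s + dot p (t - s) <= g t)%R) ->
  lower_semicontinuous (EFin \o g).
Proof.
move=> gp s a; have [p ps] := gp s; rewrite lte_fin => ag.
exists [set t | (a < g s + dot p (t - s))%R] => [|t /= at_].
  apply: (@cvgr_gt _ _ (nbhs s) _ _ (g s + dot p (s - s))%R); last first.
    by rewrite subrr dot0r addr0.
  apply: (@cvgD _ _ _ (nbhs s) _ (cst (g s)) (fun t => dot p (t - s))).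
    exact: cvg_cst.
  under eq_fun do rewrite dotBr; rewrite dotBr.
  apply: (@cvgB _ _ _ (nbhs s) _ (dot p) (cst (dot p s))); last exact: cvg_cst.
  exact: continuous_dot.
by rewrite lte_fin (lt_le_trans at_).
Qed.

(** 1-coercivity in the sup norm and free of division; functions that are [+oo] off a bounded set
    have it too. *)
Definition superlinear k := forall M : R, exists r : R,
  forall x, (r < `|x|)%R -> (M * `|x|)%:E <= k x.

Lemma one_coercive_superlinear k : one_coercive k -> superlinear k.
Proof.
(* Replacing [enorm x] by the smaller sup norm requires a nonnegative slope. *)
move=> k1 M; have [r kr] := k1 (Num.max M 0)%R; exists (Num.max r 0)%R => x.
rewrite gt_max => /andP[rx x0]; have xe := norm_le_enorm x.
have e0 : (0 < enorm x)%R by exact: lt_le_trans xe.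
have := kr x (lt_le_trans rx xe); case: (k x) => [a| |] //=.
- rewrite -EFinM !lee_fin ler_pdivlMr// => /(le_trans _); apply.
  rewrite (@le_trans _ _ (Num.max M 0 * `|x|)%R)//.
    by rewrite ler_wpM2r// le_max lexx.
  by rewrite ler_wpM2l// le_max lexx orbT.
- by rewrite leey.
- by rewrite gt0_mulNye ?lte_fin ?invr_gt0.
Qed.

(** One radius serves all slopes of norm at most [B]: a single slope gives minimisers in
    [subdiff_ex], a neighbourhood of slopes gives local boundedness in [selection_continuous]. *)
Lemma superlinear_far k x0 (B : R) : superlinear k -> k x0 < +oo ->
  exists r : R, forall s x, (`|s| <= B)%R -> (r < `|x|)%R ->
    k x0 < k x + (dot s (x0 - x))%:E.
Proof.
move=> kc kx0; pose c := (J%:R * Num.max B 0)%R.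
have c0 : (0 <= c)%R by rewrite mulr_ge0// le_max lexx orbT.
have [a kx0a] : exists a : R, k x0 <= a%:E.
  by case: (k x0) kx0 => [a| |]// _; [exists a|exists 0%R; rewrite leNye].
have [r kr] := kc (c + 1)%R; exists (Num.max r (a + c * `|x0|))%R => s x sB.
rewrite gt_max => /andP[/kr kx xa].
apply: (le_lt_trans kx0a); apply: lt_le_trans (leeD2r _ kx).
rewrite -EFinD lte_fin.
have : (`|dot s (x0 - x)| <= c * (`|x0| + `|x|))%R.
  apply: le_trans (normr_dot_le _ _) _.
  rewrite ler_pM ?mulr_ge0 ?ler_normB// ler_wpM2l// le_max sB//.
by rewrite ler_norml => /andP[+ _]; lra.
Qed.

Lemma subdiff_fin k x s : proper_fun k -> subdiff k x s -> k x \is a fin_num.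
Proof.
move=> [kN [z kz]] /(_ z) xz; rewrite fin_numElt kN/=.
rewrite ltNge leye_eq; apply/negP => /eqP kx; move: xz.
by rewrite kx addye// leye_eq => /eqP kz'; move: kz; rewrite /edom /= kz' ltxx.
Qed.

(** Having [s] as a subgradient at [x] means that [x] minimises [k - dot s], and superlinearity
    confines the search to a ball. *)
Lemma subdiff_ex k s : proper_fun k -> lower_semicontinuous k -> superlinear k ->
  exists x, subdiff k x s.
Proof.
move=> [kN [x0 kx0]] lk kc.
have [r far] := superlinear_far `|s|%R kc kx0.
have [||x xmin] := @lsc_min (fun x => k x + (dot s (x0 - x))%:E) x0 r.
- by apply: lsc_addr => //; exact: continuous_dotBr.
- by move=> x rx; rewrite subrr dot0r adde0; exact: far.
exists x => y; have := xmin y; have := xmin x0.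
rewrite subrr dot0r adde0 !dotBr.
move: kx0 (kN x) (kN y); rewrite /edom/=.
case: (k x0) => [a| |]//; case: (k x) => [b| |]//; case: (k y) => [c| |]// _ _ _.
  by rewrite -!EFinD !lee_fin; lra.
by rewrite !leey.
Qed.

Lemma conjugateE k x s : proper_fun k -> subdiff k x s ->
  conjugate k s = (dot x s - fine (k x))%:E.
Proof.
move=> kp xs; have /fineK kx := subdiff_fin kp xs.
apply/eqP; rewrite eq_le; apply/andP; split; last first.
  by apply: ereal_sup_ubound; exists x => //; rewrite EFinB kx.
apply: ge_ereal_sup => _ [y _ <-]; have := xs y; rewrite -kx.
case: (k y) (kp.1 y) => [b| |]// _; last by rewrite leNye.
rewrite -EFinD -EFinB !lee_fin dotBr (dotC y) (dotC x); lra.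
Qed.

Lemma subdiff_young k x y s t : proper_fun k -> subdiff k x s -> subdiff k y t ->
  (fine (conjugate k s) + dot x (t - s) <= fine (conjugate k t))%R.
Proof.
move=> kp xs yt; rewrite (conjugateE kp xs) (conjugateE kp yt)/=.
have := yt x; rewrite -(fineK (subdiff_fin kp xs)) -(fineK (subdiff_fin kp yt)).
rewrite -EFinD lee_fin !dotBr (dotC y) (dotC x) (dotC x t); lra.
Qed.

Section selection.
Context k (X : 'rV[R]_J -> 'rV[R]_J).
Hypotheses (kp : proper_fun k) (lk : lower_semicontinuous k) (kc : superlinear k).
Hypothesis (kX : forall s, subdiff k (X s) s).
Hypothesis (X1 : forall s x, subdiff k x s -> x = X s).

(** Near [s] the selection stays in a ball; by lower semicontinuity each of its cluster points has
    [s] as a subgradient, so is [X s] by [X1]. Compactness of the ball then forces convergence. *)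
Lemma selection_continuous : continuous X.
Proof.
move=> s; have [x0 kx0] := kp.2.
have [r far] := superlinear_far (`|s| + 1)%R kc kx0.
pose V := [set x : 'rV[R]_J | (`|x| <= Num.max r `|X s| + 1)%R].
have FV : (X @ s) V.
  have : \forall t \near s, (`|t| <= `|s| + 1)%R.
    apply: (@cvgr_le _ _ (nbhs s) _ _ `|s|%R); last by rewrite ltrDl.
    exact: norm_continuous.
  apply: filterS => t ts; rewrite /V /= leNgt; apply/negP => tX.
  have rX : (r < `|X t|)%R by apply: le_lt_trans tX; rewrite ler_wpDr// le_max lexx.
  by have := lt_le_trans (far _ _ ts rX) (kX t x0); rewrite ltxx.
have cF : cluster (X @ s) `<=` [set X s].
  move=> z cz; apply: X1 => y; rewrite leNgt; apply/negP => yz.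
  have := kp.1 y; case ky : (k y) yz => [b| |]//; last by rewrite ltNge leey.
  (* The number [a] separates [b - dot s (y - z)] from [k z]. Both inequalities persist at some
     [(t, X t)] close to [(s, z)], against the subgradient inequality at [X t]. *)
  rewrite -lteBlDr// -EFinB => /lte_dense[a /andP[]]; rewrite lte_fin => ba az _.
  have : \forall p \near (s, z), (b - dot p.1 (y - p.2) < a)%R.
    apply: (@cvgr_lt _ _ (nbhs (s, z)) _ _ (b - dot s (y - z))%R) => //.
    apply: (@cvgB _ _ _ (nbhs (s, z)) _ (cst b)); first exact: cvg_cst.
    exact: (@continuous_dotB2 _ _ y (s, z)).
  move=> [[A B] /= [As Bz] AB].
  have FA : (X @ s) (X @` A) by apply: filterS As => t At; exists t.
  have [_ [[t At <-] [Bt at_]]] := cz _ _ FA (filterI Bz (lsc_near lk az)).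
  have /= := AB (t, X t) (conj At Bt).
  have := lt_le_trans (lte_leD _ at_ (lexx (dot t (y - X t))%:E)) (kX t y).
  by rewrite ky -EFinD lte_fin => /(_ isT); lra.
have PF : ProperFilter (X @ s) := fmap_proper_filter X (nbhs_pfilter s).
have [z [_ cz]] := compact_norm_le PF FV.
have VX : nbhs (X s) V.
  have : \forall x \near X s, (`|x| < Num.max r `|X s| + 1)%R.
    apply: (@cvgr_lt _ _ (nbhs (X s)) _ _ `|X s|%R); first exact: norm_continuous.
    by rewrite ltr_pwDr// le_max lexx orbT.
  by apply: filterS => x /ltW.
apply: (compact_cluster_set1 _ (@compact_norm_le _) VX PF FV).
  exact: (@norm_hausdorff R 'rV[R]_J).
by apply/seteqP; split => // _ ->; rewrite -(cF _ cz).
Qed.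

Lemma conjugate_grad s : differentiable (fine \o conjugate k) s /\
  grad (fine \o conjugate k) s = X s.
Proof.
apply: grad_selection; last exact: selection_continuous.
by move=> t t'; exact: subdiff_young.
Qed.

End selection.
End conjugation.

(** * Subgradients of Legendre functions *)

Section convexity.
Context {R : realType} {J : nat}.
Implicit Types (f : 'rV[R]_J -> \bar R) (s u x y z : 'rV[R]_J).

Lemma convex_setP (A : set 'rV[R]_J) :
  (forall x y (t : R), 0 < t < 1 -> A x -> A y -> A (t *: x + (1 - t) *: y)) ->
  convex_set A.
Proof.
move=> cA; apply/convex_setW => x y /set_mem Ax /set_mem Ay k k0 k1.
by apply/mem_set/cA => //; rewrite k0.
Qed.

Lemma cvg_line x u : t *: u + (1 - t) *: x @[t --> (0 : R)] --> x.
Proof.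
rewrite -[X in _ --> X](_ : (0 : R) *: u + (1 - 0) *: x = x); last first.
  by rewrite scale0r add0r subr0 scale1r.
apply: cvgD; first by apply: cvgZr_tmp; exact: cvg_id.
apply: cvgZr_tmp; apply: cvgB; [exact: cvg_cst|exact: cvg_id].
Qed.

Lemma int_dom_fin f x : proper_fun f -> int_dom f x -> f x \is a fin_num.
Proof.
move=> [fN _] /interior_subset; rewrite /edom/= => fx.
by rewrite fin_numElt fN.
Qed.

Lemma int_dom_nbhs f x : int_dom f x -> nbhs x (int_dom f).
Proof. by move=> Ux; apply: open_nbhs_nbhs; split => //; exact: open_interior. Qed.

Lemma int_dom_segment f u x (t : R) : econvex f -> int_dom f u -> edom f x ->
  0 < t < 1 -> int_dom f (t *: u + (1 - t) *: x).
Proof.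
move=> cf /nbhs_normP[e /= e0 eU] fx t01; have /andP[t0 t1] := t01.
have /nbhs_normP : exists2 d : R, 0 < d &
    forall y, `|t *: u + (1 - t) *: x - y| < d -> edom f y; last by [].
(* A point within [t * e] of the combination is a combination, with the same [x], of a point [v]
   within [e] of [u]. *)
exists (t * e); first exact: mulr_gt0.
move=> y ye; pose v := t^-1 *: (y - (1 - t) *: x).
have yE : y = t *: v + (1 - t) *: x.
  by rewrite scalerA divff ?gt_eqF// scale1r subrK.
have fv : edom f v.
  apply: eU => /=; rewrite -(ltr_pM2l t0) -{1}(gtr0_norm t0) -normrZ.
  by move: ye; rewrite yE opprD addrACA subrr addr0 -scalerBr.
rewrite yE /edom/=; apply: le_lt_trans (cf _ _ _ t01) _.
by rewrite lte_add_pinfty// lte_mul_pinfty// ?lee_fin ?ltW// subr_gt0.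
Qed.

(** Convexity bounds the difference quotients at [x] towards [y] by [f y - f x], and the derivative
    is their limit. *)
Lemma egrad_subdiff f x : proper_fun f -> econvex f -> int_dom f x ->
  differentiable (fine \o f) x -> subdiff f x (egrad f x).
Proof.
move=> fp cf Ux df y; have fx := int_dom_fin fp Ux.
have [fy|] := ltP (f y) +oo%E; last by rewrite leye_eq => /eqP ->; rewrite leey.
have fyn : f y \is a fin_num by rewrite fin_numElt fp.1.
rewrite -(fineK fx) -(fineK fyn) -EFinD lee_fin -lerBrDl dot_grad.
apply: diff_le => //; near=> t.
have t0 : 0 < t by [].
have t1 : t < 1 by near: t; exact: nbhs_right_lt.
have t01 : 0 < t < 1 by rewrite t0.
have := cf y x t t01.
have -> : t *: y + (1 - t) *: x = t *: (y - x) + x.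
  by apply/rowP => i; rewrite !mxE; ring.
have : f (t *: (y - x) + x) \is a fin_num.
  apply: int_dom_fin => //; rewrite (_ : _ + _ = (1 - t) *: x + (1 - (1 - t)) *: y).
    by apply: int_dom_segment => //; rewrite subr_gt0 t1 gtrBl.
  by apply/rowP => i; rewrite !mxE; ring.
move=> /fineK /= <-; rewrite -(fineK fx) -(fineK fyn) -!EFinM -EFinD lee_fin.
by move=> /le_trans; apply; rewrite le_eqVlt; apply/orP; left; apply/eqP; ring.
Unshelve. all: by end_near. Qed.

Lemma subdiff_grad f x s : proper_fun f -> int_dom f x ->
  differentiable (fine \o f) x -> subdiff f x s -> egrad f x = s.
Proof.
move=> fp Ux df xs; apply: grad_subgradient => //.
apply: filterS (int_dom_nbhs Ux) => y Uy /=.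
have := xs y; rewrite -(fineK (int_dom_fin fp Ux)) -(fineK (int_dom_fin fp Uy)).
by rewrite -EFinD lee_fin.
Qed.

Lemma subdiff_convex f s : proper_fun f -> econvex f ->
  convex_set [set x | subdiff f x s].
Proof.
move=> fp cf; apply: convex_setP => x y t t01 xs ys w.
have /andP[t0 t1] := t01.
have fx := subdiff_fin fp xs; have fy := subdiff_fin fp ys.
have := cf x y t t01; have := xs w; have := ys w.
rewrite -(fineK fx) -(fineK fy).
move: (fp.1 (t *: x + (1 - t) *: y)) (fp.1 w).
case: (f w) => [c| |]//; last by move=> *; rewrite leey.
case: (f (t *: x + (1 - t) *: y)) => [d| |]// _ _.
rewrite -!EFinM -!EFinD !lee_fin !dotBr dotDr !dotZr => h1 h2 h3.
have : 0 <= t * (c - (fine (f x) + (dot s w - dot s x))) by rewrite mulr_ge0 ?subr_ge0// ltW.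
have : 0 <= (1 - t) * (c - (fine (f y) + (dot s w - dot s y))).
  by rewrite mulr_ge0 ?subr_ge0// ltW.
lra.
Qed.

(** Points sharing the subgradient [s] form a convex subset of [dom_subdiff f] on which [f] is
    affine; strict convexity leaves room for one. *)
Lemma subdiff_uniq f s x y : proper_fun f -> econvex f ->
  essentially_strictly_convex f -> subdiff f x s -> subdiff f y s -> x = y.
Proof.
move=> fp cf sf xs ys; apply/eqP/negPn/negP => xy.
have h : 0 < (2^-1 : R) < 1 by apply/andP; split; lra.
have sub : [set x | subdiff f x s] `<=` dom_subdiff f by move=> z zs; exists s.
have := sf _ (subdiff_convex (s := s) fp cf) sub x y _ xs ys xy h.
set z := _ + _.
have := xs z; have := ys z.
rewrite -(fineK (subdiff_fin fp xs)) -(fineK (subdiff_fin fp ys)).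
case: (f z) (fp.1 z) => [c| |]// _.
rewrite -!EFinM -!EFinD !lee_fin lte_fin !dotBr /z dotDr !dotZr; lra.
Qed.

Lemma int_dom_bounded f u : proper_fun f -> differentiable (fine \o f) u ->
  int_dom f u -> exists2 r : R, 0 < r & forall v, `|v| <= r ->
    (f (u + v)%R <= (fine (f u) + 1)%:E)%E.
Proof.
move=> fp df Uu.
have : \forall v \near u, int_dom f v /\ fine (f v) < fine (f u) + 1.
  apply: filterI; first exact: int_dom_nbhs.
  apply: (@cvgr_lt _ _ (nbhs u) _ _ (fine (f u))); last by rewrite ltrDl.
  exact: differentiable_continuous df.
move=> /nbhs_normP[e /= e0 eU]; exists (e / 2); first exact: divr_gt0.
move=> v ve; have [|Uv /ltW fv] := eU (u + v).
  by rewrite /= opprD addNKr normrN (le_lt_trans ve)// ltr_pdivrMr// ltr_pMr// ltr1n.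
by rewrite -(fineK (int_dom_fin fp Uv)) lee_fin.
Qed.

(* At a subgradient x outside U, the gradients along the segment from x to a
   point of U stay bounded, against essential smoothness. *)
Lemma subdiff_int_dom f x s : proper_fun f -> econvex f ->
  essentially_smooth f -> subdiff f x s -> int_dom f x.
Proof.
move=> fp cf [[u Uu] df sf] xs; apply: contrapT => Ux.
have fx := subdiff_fin fp xs.
have xdom : edom f x by rewrite /edom/=; case: (f x) fx => // a _; rewrite ltry.
have diffU z : int_dom f z -> differentiable (fine \o f) z by move=> Uz; apply: df; rewrite inE.
have [r r0 fr] := int_dom_bounded fp (diffU _ Uu) Uu.
pose p := dot s (u - x).
(* Testing [G] at [u + v], with [v] realising [r * enorm G], bounds
   [r * enorm G + (1 - t) * dot G (u - x)] by [f u + 1 - f z]. Since [dot G (u - x) >= p] by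
   monotonicity of subgradients and [f z >= f x + t * p], the parameter [t] drops out. *)
pose M := (fine (f u) + 1 - fine (f x) - p) / r.
have bound t : 0 < t < 1 -> enorm (egrad f (t *: u + (1 - t) *: x)) <= M.
  move=> t01; have /andP[t0 t1] := t01.
  set z := _ + _; set G := egrad f z.
  have Uz : int_dom f z by exact: int_dom_segment.
  have zG := egrad_subdiff fp cf Uz (diffU _ Uz).
  have zx : z - x = t *: (u - x).
    by apply/rowP => i; rewrite !mxE; ring.
  have [v vr Gv] := dot_ball_attained G (ltW r0).
  have uvz : u + v - z = (1 - t) *: (u - x) + v.
    by apply/rowP => i; rewrite !mxE; ring.
  have := xs z; have := zG x; have := le_trans (zG (u + v)) (fr _ vr).
  have xz : x - z = - (t *: (u - x)) by rewrite -zx opprB.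
  rewrite uvz xz zx -(fineK fx) -(fineK (int_dom_fin fp Uz)) -!EFinD !lee_fin.
  rewrite dotDr Gv dotNr !dotZr -/p => h1 h2 h3.
  have pG : p <= dot G (u - x) by rewrite -(ler_pM2l t0); lra.
  have : 0 <= (1 - t) * (dot G (u - x) - p) by rewrite mulr_ge0 ?subr_ge0// ltW.
  by rewrite /M ler_pdivlMr// mulrC; lra.
(* The shift by two keeps [t_ 0] strictly below 1. *)
pose t_ n : R := n.+2%:R^-1.
have t01 n : 0 < t_ n < 1.
  by rewrite invr_gt0 ltr0n invf_lt1 ?ltr0n// ltr1n.
have t0 : t_ n @[n --> \oo] --> (0 : R).
  by have := @cvg_harmonic R; rewrite -cvg_shiftS.
have xn := cvg_comp t_ (fun t => t *: u + (1 - t) *: x) t0 (@cvg_line x u).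
have Un n : int_dom f (t_ n *: u + (1 - t_ n) *: x) by exact: int_dom_segment.
have clx : closure (int_dom f) x.
  by move=> B /xn[N _ NB]; exists (t_ N *: u + (1 - t_ N) *: x); split => //; apply: NB => /=.
have /cvgryPgt/(_ M)[N _ NM] := sf _ x Un (conj clx Ux) xn.
by have := NM N (leqnn N); rewrite ltNge => /negP; apply; exact: bound.
Qed.

End convexity.

(** * Derivatives of inner products and symmetry of the Hessian *)

Section second_order.
Context {R : realType} {J : nat}.
Implicit Types (g : 'rV[R]_J -> R) (G : 'rV[R]_J -> 'rV[R]_J) (u v w x y : 'rV[R]_J).

Lemma dot_is_bilinear : bilinear_for
  (GRing.Scale.Law.clone _ _ *:%R _) (GRing.Scale.Law.clone _ _ *:%R _)
  (@dot R J).
Proof.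
by split=> [u'|u] a x y /=; rewrite ?dotDl ?dotDr ?dotZl ?dotZr.
Qed.

HB.instance Definition _ :=
  bilinear_isBilinear.Build R 'rV[R]_J 'rV[R]_J R _ _ (@dot R J) dot_is_bilinear.

Lemma continuous_dot2 : continuous (fun p : 'rV[R]_J * 'rV[R]_J => dot p.1 p.2).
Proof.
by move=> p; apply: (@cvg_dot _ _ _ (nbhs p) _ fst snd); [exact: cvg_fst|exact: cvg_snd].
Qed.

Lemma is_diff_dot G H x : differentiable G x -> differentiable H x ->
  is_diff x (fun y => dot (G y) (H y))
    (fun v => dot (G x) ('d H x v) + dot ('d G x v) (H x)).
Proof.
move=> dG dH.
have dGH := differentiable_pair dG dH.
have dd := @differentiable_bilin _ _ _ _ (@dot R J) (G x, H x) continuous_dot2.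
apply: DiffDef; first exact: (differentiable_comp dGH dd).
rewrite -[LHS]/('d ((fun q => dot q.1 q.2) \o (fun y => (G y, H y))) x : _ -> _).
rewrite diff_comp// diff_pair// (diff_bilin _ continuous_dot2).
by [].
Qed.

Lemma hessianE g x v : v *m hessian g x = 'd (grad g) x v.
Proof. exact: mul_rV_lin1. Qed.

Lemma diff_epsilon (V W : normedModType R) (F : V -> W) (x : V) (e : R) :
  differentiable F x -> 0 < e ->
  \forall h \near (0 : V), `|F (h + x) - (F x + 'd F x h)| <= e * `|h|.
Proof.
by move=> /diff_locallyP[_ /eqaddoP dF] e0; have := dF _ e0.
Qed.

Lemma near_eq_differentiable g (h : 'rV[R]_J -> R) x :
  (\forall y \near x, g y = h y) -> differentiable h x ->
  differentiable g x /\ grad g x = grad h x.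
Proof.
move=> gh dh; apply: grad_epsilon => e e0.
have gx : g x = h x by exact: nbhs_singleton gh.
have : \forall k \near (0 : 'rV[R]_J), g (k + x) = h (k + x).
  exact: near_shift0 gh.
have := diff_epsilon dh e0.
by apply: filterS2 => k; rewrite dot_grad gx => + ->.
Qed.

Lemma is_derive_line g u w (t : R) : differentiable g (t *: u + w) ->
  is_derive t 1 (fun r => g (r *: u + w)) (dot (grad g (t *: u + w)) u).
Proof.
move=> dg; rewrite dot_grad -deriveE//.
have E : (fun h : R => h^-1 *: (((fun r => g (r *: u + w)) \o shift t) (h *: 1)
    - g (t *: u + w))) =
  (fun h => h^-1 *: ((g \o shift (t *: u + w)) (h *: u) - g (t *: u + w))).
  by apply/funext => h /=; rewrite -[h *: 1]/(h * 1) mulr1 scalerDl addrA.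
have /= dv := @diff_derivable _ _ _ g (t *: u + w) u dg.
by split; [rewrite /derivable E|rewrite /derive E].
Qed.

(** The mean value theorem along [u] turns the second difference into a difference of two gradients,
    each of which is compared with the expansion of [grad g] at [x]. *)
Lemma second_difference g x u v (e : R) :
  (\forall y \near x, differentiable g y) -> differentiable (grad g) x ->
  0 < e -> \forall t \near (0 : R)^'+,
    `|g (t *: u + (t *: v + x)) - g (t *: u + x) - (g (t *: v + x) - g x)
      - t ^+ 2 * dot ('d (grad g) x v) u| <= e * t ^+ 2.
Proof.
move=> dg dG e0; set L := 'd (grad g) x.
(* The outer factors come from [normr_dot_le]; the middle one, times [t], bounds the sum of the
   norms of the displacements [r *: u + t *: v] and [r *: u]. *)
pose c := J%:R * (2 * `|u| + `|v|) * `|u|.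
have c0 : 0 <= c by rewrite !mulr_ge0// addr_ge0// mulr_ge0.
pose e1 := e / (c + 1).
have e10 : 0 < e1 by rewrite divr_gt0// ltr_wpDl.
have : \forall h \near (0 : 'rV[R]_J), differentiable g (h + x) /\
    `|grad g (h + x) - (grad g x + L h)| <= e1 * `|h|.
  by apply: filterI; [exact: near_shift0 dg|exact: diff_epsilon dG e10].
move=> /nbhs_normP[d /= d0 dP].
have {dP} dP h : `|h| < d -> differentiable g (h + x) /\
    `|grad g (h + x) - (grad g x + L h)| <= e1 * `|h|.
  by move=> hd; apply: dP; rewrite /= sub0r normrN.
pose b := `|u| + `|v| + 1.
have b0 : 0 < b by rewrite ltr_wpDl// addr_ge0.
near=> t.
have t0 : 0 < t by [].
have tb : t * b < d.
  by rewrite -ltr_pdivlMr//; near: t; apply: nbhs_right_lt; rewrite divr_gt0.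
have small (r q : R) : 0 <= r <= t -> 0 <= q <= t -> `|r *: u + q *: v| < d.
  move=> /andP[r0 rt] /andP[q0 qt]; apply: le_lt_trans tb.
  rewrite (le_trans (ler_normD _ _))// !normrZ !ger0_norm// /b !mulrDr mulr1.
  by rewrite ler_wpDr ?(ltW t0)// lerD// ler_wpM2r.
have t01 : 0 <= t <= t by rewrite lexx ltW.
have z01 : 0 <= (0 : R) <= t by rewrite lexx ltW.
pose p r := g (r *: u + (t *: v + x)) - g (r *: u + x).
pose dp r := dot (grad g (r *: u + (t *: v + x))) u - dot (grad g (r *: u + x)) u.
have dp1 r : 0 <= r <= t -> is_derive r 1 p (dp r).
  move=> rt; apply: is_deriveB.
    by apply: is_derive_line; rewrite addrA; apply: (dP _ _).1; exact: small.
  apply: is_derive_line; have := (dP _ (small r 0 rt z01)).1.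
  by rewrite scale0r addr0.
have alg (r : R) (a1 a2 a3 a4 a5 : 'rV[R]_J) :
    (dot a1 u - dot a2 u) * t - t ^+ 2 * dot a4 u =
    t * dot (a1 - (a3 + (r *: a5 + t *: a4)) - (a2 - (a3 + r *: a5))) u.
  by rewrite !dotBl !dotDl !dotZl; ring.
have [||r +] := @MVT R p dp 0 t t0.
- by move=> r; rewrite in_itv/= => /andP[r0 rt]; apply: dp1; rewrite !ltW.
- apply: derivable_within_continuous => r; rewrite in_itv/= => rt.
  by have [] := dp1 r rt.
rewrite in_itv/= => /andP[/ltW r0 /ltW rt].
rewrite /p !scale0r !add0r subr0 => ->.
have rt1 : 0 <= r <= t by rewrite r0.
have [_ h1] := dP _ (small r t rt1 t01).
have [_ h2] := dP _ (small r 0 rt1 z01).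
rewrite -addrA in h1; rewrite scale0r addr0 in h2.
rewrite (_ : L _ = r *: L u + t *: L v) in h1; last first.
  by rewrite [LHS]linearD [L (r *: u)]linearZ [L (t *: v)]linearZ.
rewrite (_ : L _ = r *: L u) in h2; last exact: linearZ.
rewrite /dp (alg r _ _ (grad g x) (L v) (L u)).
rewrite normrM (gtr0_norm t0) expr2 mulrCA ler_wpM2l ?(ltW t0)//.
apply: le_trans (normr_dot_le _ _) _.
have hu : `|r *: u + t *: v| <= t * (`|u| + `|v|).
  rewrite (le_trans (ler_normD _ _))// !normrZ !ger0_norm ?(ltW t0)// mulrDr.
  by rewrite lerD2r ler_wpM2r.
have hr : `|r *: u| <= t * `|u| by rewrite normrZ ger0_norm// ler_wpM2r.
apply: (@le_trans _ _ (J%:R * (e1 * (t * (2 * `|u| + `|v|))) * `|u|)).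
  rewrite ler_wpM2r// ler_wpM2l// (le_trans (ler_normB _ _))//.
  rewrite (le_trans (lerD h1 h2))// -mulrDr ler_wpM2l ?(ltW e10)//.
  by apply: le_trans (lerD hu hr) _; rewrite le_eqVlt; apply/orP; left; apply/eqP; ring.
have -> : J%:R * (e1 * (t * (2 * `|u| + `|v|))) * `|u| = t * (e1 * c).
  by rewrite /c; ring.
rewrite mulrC ler_wpM2r ?(ltW t0)// /e1 mulrAC ler_pdivrMr ?ltr_wpDl//.
by rewrite mulrDr mulr1 lerDl ltW.
Unshelve. all: by end_near. Qed.

(* Both sides are limits of the second difference quotient, which is symmetric
   in u and v. *)
Lemma hessian_sym g x u v :
  (\forall y \near x, differentiable g y) -> differentiable (grad g) x ->
  dot (u *m hessian g x) v = dot (v *m hessian g x) u.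
Proof.
move=> dg dG; rewrite !hessianE; apply/eqP; rewrite -subr_eq0 -normr_eq0.
rewrite eq_le normr_ge0 andbT; apply/ler_addgt0Pr => e e0; rewrite add0r.
have e2 : 0 < e / 2 by rewrite divr_gt0.
move: (second_difference u v dg dG e2) (second_difference v u dg dG e2).
move: (dot _ v) (dot _ u) => A B huv hvu.
have : \forall t \near (0 : R)^'+, `|A - B| <= e.
  apply: filterS3 huv hvu (nbhs_right_gt 0) => t duv dvu t0; rewrite (addrCA (t *: v)) in dvu.
  have t2 : 0 < t ^+ 2 by rewrite exprn_gt0.
  rewrite -(ler_pM2l t2) -{1}(gtr0_norm t2) -normrM.
  apply: (@le_trans _ _ (e / 2 * t ^+ 2 + e / 2 * t ^+ 2)); last first.
    by rewrite le_eqVlt; apply/orP; left; apply/eqP; field.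
  apply: le_trans _ (lerD duv dvu); apply: le_trans _ (ler_normB _ _).
  by rewrite le_eqVlt; apply/orP; left; apply/eqP; congr (`|_|); ring.
by move=> /filter_ex[].
Qed.

Lemma cvg_mx (T : Type) (F : set_system T) {FF : Filter F} (m n : nat)
    (g : T -> 'M[R]_(m, n)) (A : 'M[R]_(m, n)) :
  (forall i j, g x i j @[x --> F] --> A i j) -> g @ F --> A.
Proof.
move=> gA B [P AP PB].
have : \forall x \near F, forall p : 'I_m * 'I_n, P p.1 p.2 (g x p.1 p.2).
  by apply: filter_forall => -[i j] /=; apply: gA; exact: AP.
by apply: filterS => x xP; apply: PB => i j; exact: (xP (i, j)).
Qed.

Lemma cvg_mulmx (T : Type) (F : set_system T) {FF : Filter F} (m n p : nat)
    (g : T -> 'M[R]_(m, n)) (h : T -> 'M[R]_(n, p)) (A : 'M[R]_(m, n)) (B : 'M[R]_(n, p)) :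
  g @ F --> A -> h @ F --> B -> g x *m h x @[x --> F] --> A *m B.
Proof.
move=> gA hB; apply: cvg_mx => i j; rewrite mxE; under eq_fun do rewrite mxE.
apply: cvg_big => [|k _]; first exact: add_continuous.
by apply: cvgM; exact: cvg_coord.
Qed.

End second_order.

(** * The gradients of f and of its conjugate as mutual inverses *)

Section conjugate_gradient.
Context {R : realType} {J : nat}.
Variable f : 'rV[R]_J -> \bar R.
Implicit Types s x y : 'rV[R]_J.
Hypotheses (fL : convex_Legendre f) (f1 : one_coercive f).

Local Notation gs := (egrad (conjugate f)).

Let fp : proper_fun f. Proof. by case: fL. Qed.
Let cf : econvex f. Proof. by case: fL. Qed.
Let sf : essentially_smooth f. Proof. by case: fL. Qed.
Let ef : essentially_strictly_convex f. Proof. by case: fL. Qed.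

Lemma Legendre_differentiable x : int_dom f x -> differentiable (fine \o f) x.
Proof. by case: sf => _ df _ Ux; apply: df; rewrite inE. Qed.

(** Each slope is a subgradient of [f] at some point, unique by strict convexity; the gradient of
    the conjugate is this selection and inherits its continuity. *)
Lemma conjugate_egrad s : [/\ differentiable (fine \o conjugate f) s,
  {for s, continuous gs} & subdiff f (gs s) s].
Proof.
have lf : lower_semicontinuous f by case: fL.
have fs := one_coercive_superlinear f1.
have [X fX] := choice (fun s => subdiff_ex s fp lf fs).
have X1 t x : subdiff f x t -> x = X t.
  by move=> xt; exact: (subdiff_uniq fp cf ef xt (fX t)).
have gsE : gs = X.
  by apply/funext => t; exact: (conjugate_grad fp lf fs fX X1 t).2.
rewrite gsE; split; [exact: (conjugate_grad fp lf fs fX X1 s).1| |exact: fX].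
exact: (selection_continuous fp lf fs fX X1).
Qed.

Lemma egrad_conjugate_subdiff s : subdiff f (gs s) s.
Proof. by have [] := conjugate_egrad s. Qed.

Lemma egrad_conjugate_int s : int_dom f (gs s).
Proof. exact: subdiff_int_dom (egrad_conjugate_subdiff s). Qed.

Lemma egrad_conjugateK : cancel gs (egrad f).
Proof.
move=> s; have Us := egrad_conjugate_int s.
by apply: subdiff_grad (egrad_conjugate_subdiff s) => //; exact: Legendre_differentiable.
Qed.

Lemma egradK y : int_dom f y -> gs (egrad f y) = y.
Proof.
move=> Uy; apply: (subdiff_uniq fp cf ef (egrad_conjugate_subdiff _)).
by apply: egrad_subdiff => //; exact: Legendre_differentiable.
Qed.

Lemma int_dom_subdiff y : int_dom f y -> subdiff f y (egrad f y).
Proof. by move=> Uy; apply: egrad_subdiff => //; exact: Legendre_differentiable. Qed.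

Lemma int_dom_convex : convex_set (int_dom f).
Proof.
apply: convex_setP => x y t t01 Ux Uy; apply: int_dom_segment => //.
exact: (interior_subset Uy).
Qed.

End conjugate_gradient.

(** * Farthest points for the left Bregman distance *)

Section left_bregman.
Context {R : realType} {J : nat}.
Variables (f : 'rV[R]_J -> \bar R) (C : set 'rV[R]_J).
Implicit Types s x y z : 'rV[R]_J.
Hypotheses (fL : convex_Legendre f) (f1 : one_coercive f).
Hypotheses (C0 : C !=set0) (Cb : bounded_set C) (Cc : closed C).
Hypothesis CU : C `<=` int_dom f.
(* gs is the gradient of the conjugate of f; keeping it abstract stops
   unification from unfolding derivatives. *)
Variable gs : 'rV[R]_J -> 'rV[R]_J.
Hypotheses (gsU : forall s, int_dom f (gs s)) (gsK : cancel gs (egrad f)).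
Hypotheses (egK : forall y, int_dom f y -> gs (egrad f y) = y).
Hypothesis gs_cont : continuous gs.

Local Notation U := (int_dom f).
Local Notation F := (left_farthest_distr f C).
Local Notation Q := (left_farthest_pt f C).
Local Notation k := (neg_reflect_on f C).

Let fp : proper_fun f. Proof. by case: fL. Qed.
Let cf : econvex f. Proof. by case: fL. Qed.
Let ef : essentially_strictly_convex f. Proof. by case: fL. Qed.
Let Ufin x : U x -> f x \is a fin_num. Proof. exact: int_dom_fin. Qed.

Definition bregmanr x y : R := fine (f x) - fine (f y) - dot (egrad f y) (x - y).

Lemma bregmanE x y : U x -> U y -> bregman f x y = (bregmanr x y)%:E.
Proof.
move=> Ux Uy; rewrite /bregman mem_set// /bregmanr.
by rewrite -{1}(fineK (Ufin Ux)) -{1}(fineK (Ufin Uy)) -!EFinB.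
Qed.

(** A nonpositive distance makes [egrad f y] a subgradient at [x] as well as at [y]. *)
Lemma bregmanr_le0 x y : U x -> U y -> bregmanr x y <= 0 -> x = y.
Proof.
move=> Ux Uy xy.
have ys := int_dom_subdiff fL Uy; apply: (subdiff_uniq fp cf ef _ ys) => z.
apply: le_trans (ys z); rewrite -(fineK (Ufin Ux)) -(fineK (Ufin Uy)) -!EFinD lee_fin.
by move: xy; rewrite /bregmanr !dotBr; lra.
Qed.

Lemma left_farthest_mapP x y : U y ->
  left_farthest_map f C y x <->
  C x /\ forall z, C z -> bregmanr z y <= bregmanr x y.
Proof.
move=> Uy; split => -[Cx xmax]; split => // z Cz; have := xmax z Cz;
  by rewrite !bregmanE ?lee_fin//; exact: CU.
Qed.

Lemma neg_reflect_onE x : C x -> k (- x) = (- fine (f x))%:E.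
Proof.
move=> Cx; rewrite /neg_reflect_on mem_set; last by exists x.
by rewrite opprK EFinN fineK// Ufin//; exact: CU.
Qed.

Lemma neg_reflect_on_out x : ~ C x -> k (- x) = +oo%E.
Proof.
move=> Cx; rewrite /neg_reflect_on memNset// => -[c Cc' /oppr_inj cx].
by apply: Cx; rewrite -cx.
Qed.

Lemma neg_reflect_on_subdiff x s :
  subdiff k (- x) s <->
  C x /\ forall z, C z -> fine (f z) - dot s z <= fine (f x) - dot s x.
Proof.
have [c Cc'] := C0.
split => [xs|[Cx xmax] w].
  have Cx : C x.
    apply: contrapT => Cx; have := xs (- c).
    by rewrite (neg_reflect_onE Cc') (neg_reflect_on_out Cx).
  split => // z Cz; have := xs (- z).
  by rewrite !neg_reflect_onE// -EFinD lee_fin dotBr !dotNr; lra.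
rewrite -(opprK w); have [Cw|Cw] := pselect (C (- w)); last first.
  by rewrite (neg_reflect_on_out Cw) leey.
rewrite !neg_reflect_onE// -EFinD lee_fin dotBr !dotNr.
by have := xmax _ Cw; lra.
Qed.

(** Up to terms independent of [x], the distance to [y] is [f x - dot (egrad f y) x]; reflection
    turns its maximisation over [C] into minimisation of [k - dot (egrad f y)]. *)
Lemma left_farthest_subdiff x y : U y ->
  left_farthest_map f C y x <-> subdiff k (- x) (egrad f y).
Proof.
move=> Uy; rewrite neg_reflect_on_subdiff left_farthest_mapP//.
by split=> -[Cx xmax]; split => // z /xmax; rewrite /bregmanr !dotBr; lra.
Qed.

Lemma neg_reflect_on_proper : proper_fun k.
Proof.
split => [x|]; last first.
  by have [c Cc'] := C0; exists (- c); rewrite /edom/= neg_reflect_onE// ltry.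
rewrite -(opprK x); have [Cx|Cx] := pselect (C (- x)).
  by rewrite neg_reflect_onE// ltNyr.
by rewrite neg_reflect_on_out.
Qed.

Lemma neg_reflect_on_lsc : lower_semicontinuous k.
Proof.
move=> x a; rewrite -(opprK x); set y := - x => ay.
have yx : - y = x by rewrite /y opprK.
have cN : {for x, continuous (@GRing.opp 'rV[R]_J)} by exact: opp_continuous.
(* On [C] the function [f] is continuous because [C] lies in [U]; off the closed set [C], [k] is
   infinite nearby. *)
have [Cy|Cy] := pselect (C y).
  have : \forall z \near y, a < - fine (f z).
    apply: (@cvgr_gt _ _ (nbhs y) _ _ (- fine (f y))).
      apply: (@cvgN _ _ _ (nbhs y) _ (fine \o f)).
      apply: differentiable_continuous; apply: (Legendre_differentiable fL).
      exact: CU.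
    by move: ay; rewrite neg_reflect_onE// lte_fin.
  move=> /cN Vx; rewrite yx; exists [set z | a < - fine (f (- z))]; first exact: Vx.
  move=> z /= az; rewrite -(opprK z); have [Cz|Cz] := pselect (C (- z)).
    by rewrite neg_reflect_onE// lte_fin.
  by rewrite neg_reflect_on_out// ltry.
rewrite yx; exists (-%R @^-1` (~` C)).
  by apply: cN; apply: open_nbhs_nbhs; split => //; exact: closed_openC.
by move=> z /= Cz; rewrite -(opprK z) neg_reflect_on_out// ltry.
Qed.

Lemma neg_reflect_on_superlinear : superlinear k.
Proof.
have [M [_ MC]] := Cb; move=> a; exists (M + 1) => x xM.
rewrite -(opprK x) neg_reflect_on_out ?leey// => Cx.
have /= := MC (M + 1) _ (- x) Cx; rewrite ltrDl ltr01 => /(_ isT).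
by rewrite normrN leNgt xM.
Qed.

Lemma left_farthest_ex y : U y -> exists x, left_farthest_map f C y x.
Proof.
move=> Uy; have [x xs] := subdiff_ex (egrad f y) neg_reflect_on_proper
  neg_reflect_on_lsc neg_reflect_on_superlinear.
by exists (- x); apply/left_farthest_subdiff => //; rewrite opprK.
Qed.

Lemma left_farthest_distrE x y : U y -> left_farthest_map f C y x ->
  F y = bregmanr x y.
Proof.
move=> Uy [Cx xmax]; rewrite /left_farthest_distr.
suff -> : left_farthest_dist f C y = bregman f x y by rewrite bregmanE//; exact: CU.
apply/eqP; rewrite eq_le; apply/andP; split.
  by apply: ge_ereal_sup => _ [z Cz <-]; exact: xmax.
by apply: ereal_sup_ubound; exists x.
Qed.

Lemma bregmanr_le_farthest x y : U y -> C x -> bregmanr x y <= F y.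
Proof.
move=> Uy Cx; have [z yz] := left_farthest_ex Uy.
rewrite (left_farthest_distrE Uy yz).
by move: yz => /left_farthest_mapP -/(_ Uy)[_]; apply.
Qed.

(** [F (gs t)] is at least [bregmanr x (gs t)], and the gap [bregmanr x (gs t) - bregmanr x (gs s) -
    dot (gs s - x) (t - s)] equals [bregmanr (gs s) (gs t)], which is nonnegative. *)
Lemma farthest_subgradient s t x : left_farthest_map f C (gs s) x ->
  F (gs s) + dot (gs s - x) (t - s) <= F (gs t).
Proof.
move=> sx; have Us := gsU s.
have Ut := gsU t.
rewrite (left_farthest_distrE Us sx).
apply: le_trans (bregmanr_le_farthest Ut sx.1).
have := int_dom_subdiff fL Ut (gs s).
rewrite -(fineK (Ufin Us)) -(fineK (Ufin Ut)) -EFinD lee_fin.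
rewrite /bregmanr !gsK.
rewrite !dotBr !dotBl.
by rewrite (dotC _ t) (dotC _ s) (dotC x t) (dotC x s); lra.
Qed.

Lemma farthest_grad s x : differentiable (F \o gs) s ->
  left_farthest_map f C (gs s) x -> grad (F \o gs) s = gs s - x.
Proof.
move=> dF sx; apply: grad_subgradient => //.
by apply: (@filterE _ (nbhs s)) => t; exact: farthest_subgradient.
Qed.

Lemma farthest_min : exists s, forall t, F (gs s) <= F (gs t).
Proof.
have [c Cc'] := C0; have Uc := CU Cc'.
have [r r0 fr] := int_dom_bounded fp (Legendre_differentiable fL Uc) Uc.
have lF : lower_semicontinuous (EFin \o (F \o gs)).
  apply: lsc_subgradient => s.
  have [x sx] := left_farthest_ex (gsU s).
  by exists (gs s - x) => t; exact: farthest_subgradient.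
(* The subgradient inequality at [gs s] is tested at [c + v], where [v] realises [r * enorm s]; the
   1 is the margin from [int_dom_bounded]. *)
have coer s : r * `|s| - 1 <= F (gs s).
  have Us := gsU s.
  apply: le_trans (bregmanr_le_farthest Us Cc').
  have [v vr sv] := dot_ball_attained s (ltW r0).
  have := le_trans (int_dom_subdiff fL Us (c + v)) (fr _ vr).
  rewrite -(fineK (Ufin Us)) -EFinD lee_fin /bregmanr !gsK.
  rewrite !dotBr dotDr sv => h.
  have : r * `|s| <= r * enorm s by rewrite ler_wpM2l ?norm_le_enorm// ltW.
  by lra.
have [|s smin] := lsc_min (x0 := 0) (r := (F (gs 0) + 1) / r) lF.
  move=> s; rewrite ltr_pdivrMr// lte_fin => /= Fs.
  by have := coer s; lra.
by exists s => t; have := smin t; rewrite lee_fin.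
Qed.

Lemma farthest_self y : U y -> left_farthest_map f C y y -> C = [set y].
Proof.
move=> Uy /left_farthest_mapP-/(_ Uy)[Cy ymax].
apply/seteqP; split=> [x Cx|_ ->//]; apply: bregmanr_le0 => //; first exact: CU.
by rewrite (le_trans (ymax _ Cx))// /bregmanr !subrr dot0r subr0.
Qed.

(* A minimizer y of F over U is its own farthest point. *)
Lemma differentiable_singleton : (forall s, differentiable (F \o gs) s) ->
  exists c, C = [set c].
Proof.
move=> dF; have [s smin] := farthest_min.
have Us := gsU s; have [x sx] := left_farthest_ex Us.
have : grad (F \o gs) s = 0.
  by apply: (grad_min (dF s)); apply: (@filterE _ (nbhs s)) => t; exact: smin.
rewrite (farthest_grad (dF s) sx) => /subr0_eq sE.
by exists (gs s); apply: farthest_self => //; rewrite {2}sE.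
Qed.

Lemma left_farthest_ptP y : U y -> left_farthest_map f C y (Q y).
Proof. by move=> /left_farthest_ex; exact: xgetPex. Qed.

(** The Klee property says that each slope [s] is a subgradient of [k] at the point [- Q (gs s)]
    only, so [selection_continuous] applies to [k]. *)
Lemma Klee_continuous : left_Klee f C -> continuous (Q \o gs).
Proof.
move=> kl; pose X s := - Q (gs s).
suff cX : continuous X.
  move=> s; have -> : Q \o gs = -%R \o X by apply/funext => t; rewrite /= /X opprK.
  by apply: continuous_comp; [exact: cX|exact: opp_continuous].
have XE s x : subdiff k x s <-> left_farthest_map f C (gs s) (- x).
  have Us := gsU s.
  by rewrite left_farthest_subdiff// opprK gsK.
apply: (selection_continuous neg_reflect_on_proper neg_reflect_on_lsc
  neg_reflect_on_superlinear) => s.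
  apply/XE; rewrite /X opprK; apply: left_farthest_ptP.
  exact: gsU.
move=> x /XE sx; have Us := gsU s.
have [q qE] := kl _ Us; have := left_farthest_ptP Us.
by move: sx; rewrite /X qE => /= <- ->; rewrite opprK.
Qed.

Lemma Klee_differentiable s : left_Klee f C ->
  differentiable (F \o gs) s /\ grad (F \o gs) s = gs s - Q (gs s).
Proof.
move=> kl; apply: (@grad_selection _ _ _ (fun s => gs s - Q (gs s))).
  move=> t t'; apply: farthest_subgradient; apply: left_farthest_ptP.
  exact: gsU.
apply: (@cvgB _ _ _ (nbhs s) _ gs (Q \o gs)); first exact: gs_cont.
exact: (Klee_continuous kl).
Qed.

Lemma Klee_continuously_differentiable : left_Klee f C ->
  continuously_differentiable_on setT (F \o gs).
Proof.
move=> kl; split=> [s _|]; first exact: (Klee_differentiable s kl).1.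
apply: continuous_subspaceT => s.
have -> : grad (F \o gs) = gs - (Q \o gs).
  by apply/funext => t; exact: (Klee_differentiable t kl).2.
apply: (@cvgB _ _ _ (nbhs s) _ gs (Q \o gs)); first exact: gs_cont.
exact: (Klee_continuous kl).
Qed.

Lemma singleton_left_farthest_map c y : C = [set c] -> U y ->
  left_farthest_map f C y = [set c].
Proof.
move=> CE Uy; apply/seteqP; split => [x []|_ ->]; first by rewrite CE.
by rewrite /left_farthest_map CE; split => // z ->.
Qed.

Lemma singleton_left_farthest_pt c y : C = [set c] -> U y -> Q y = c.
Proof.
by move=> CE Uy; have := left_farthest_ptP Uy; rewrite (singleton_left_farthest_map CE Uy).
Qed.

(** Convexity of [k] puts midpoints of [C] into [C], where [k] is finite, and makes [f] midpoint
    concave there; strict convexity of [f] on [U] forbids this for distinct points. *)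
Lemma econvex_singleton : econvex k -> exists c, C = [set c].
Proof.
move=> ck; have [c Cc'] := C0; exists c; apply/seteqP; split => [x Cx|_ ->//].
apply/eqP/negPn/negP => xc.
have h : 0 < (2^-1 : R) < 1 by apply/andP; split; lra.
have Us : U `<=` dom_subdiff f by move=> y Uy; exists (egrad f y); exact: int_dom_subdiff.
have := ef (int_dom_convex fL) Us (CU Cx) (CU Cc') xc h.
have := ck (- x) (- c) _ h.
rewrite !neg_reflect_onE// !scalerN -opprD; set m := _ *: x + _.
have [Cm|Cm] := pselect (C m); last first.
  by rewrite neg_reflect_on_out// -!EFinM -EFinD leye_eq.
rewrite neg_reflect_onE// -(fineK (Ufin (CU Cx))) -(fineK (Ufin (CU Cc'))).
rewrite -(fineK (Ufin (CU Cm))) -!EFinM -!EFinD lee_fin lte_fin; lra.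
Qed.

Lemma singleton_econvex c : C = [set c] -> econvex k.
Proof.
move=> CE x y t t01; have /andP[t0 t1] := t01.
(* Excluding [-oo] lets a single [+oo] summand absorb the right-hand side. *)
have mulkN r z : 0 < r -> (r%:E * k z != -oo)%E.
  move=> r0; case: (k z) (neg_reflect_on_proper.1 z) => [a| |]//.
  by rewrite gt0_muley.
have [Cx|Cx] := pselect (C (- x)); last first.
  by rewrite -[in X in (_ <= X + _)%E](opprK x) neg_reflect_on_out// gt0_muley ?addye ?leey
    ?mulkN ?subr_gt0.
have [Cy|Cy] := pselect (C (- y)); last first.
  by rewrite -[in X in (_ <= _ + X)%E](opprK y) neg_reflect_on_out// gt0_muley ?addey ?leey
    ?mulkN ?lte_fin ?subr_gt0.
have Cc' : C c by rewrite CE.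
have xc : - x = c by move: Cx; rewrite CE.
have yc : - y = c by move: Cy; rewrite CE.
have -> : y = x by apply: oppr_inj; rewrite xc yc.
rewrite -scalerDl addrC subrK scale1r -[x]opprK xc neg_reflect_onE//.
by rewrite -!EFinM -EFinD lee_fin -mulrDl addrC subrK mul1r.
Qed.

(** The two terms [dot (egrad f y) v], from [- f y] and from [x - y], cancel; only the derivative of
    the gradient survives. *)
Lemma bregmanr_diff x y : U y -> differentiable (egrad f) y ->
  differentiable (bregmanr x) y /\
  forall v, 'd (bregmanr x) y v = dot (v *m hessian (fine \o f) y) (y - x).
Proof.
move=> Uy dG; have df := Legendre_differentiable fL Uy.
have dx : is_diff y (cst x - id : 'rV[R]_J -> 'rV[R]_J) (0 - id).
  exact: is_diffB (is_diff_cst x y) (is_diff_id y).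
have dxE v : 'd (cst x - id : 'rV[R]_J -> 'rV[R]_J) y v = - v.
  by rewrite (diff_val (is_diff_def := dx)) /= sub0r.
have dA := is_diffB (is_diff_cst (fine (f x)) y) (differentiableP df).
have dB := is_diffB dA (is_diff_dot dG (ex_diff (is_diff_def := dx))).
have {}dB : is_diff y (bregmanr x) _ := dB.
split=> [|v]; first exact: (ex_diff (is_diff_def := dB)).
rewrite (diff_val (is_diff_def := dB)) hessianE.
rewrite -[LHS]/((0 - 'd (fine \o f) y v) - (dot (egrad f y)
  ('d (cst x - id : 'rV[R]_J -> 'rV[R]_J) y v) + dot ('d (egrad f) y v) (x - y))).
have alg (a : R) (G w h : 'rV[R]_J) : a = dot G v -> w = - v ->
    (0 - a) - (dot G w + dot h (x - y)) = dot h (y - x).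
  by move=> -> ->; rewrite dotNr !dotBr; ring.
apply: alg (dxE v); exact/esym/dot_grad.
Qed.

Lemma differentiable_farthest_singleton :
  (forall y, U y -> differentiable (egrad f) y) ->
  {in U, forall y, positive_definite (hessian (fine \o f) y)} ->
  {in U, forall y, differentiable F y} -> exists c, C = [set c].
Proof.
move=> dG pH dF; have [s smin] := farthest_min.
set y := gs s in smin; have Uy : U y by exact: gsU.
have [x yx] := left_farthest_ex Uy.
have dFy : differentiable F y by apply: dF; rewrite inE.
have ymin : \forall z \near y, F y <= F z.
  by apply: filterS (int_dom_nbhs Uy) => z Uz; rewrite -(egK Uz).
have [dB BE] := bregmanr_diff x Uy (dG _ Uy).
have gF := grad_min dFy ymin.
have dFB := differentiableB dFy dB.
(* The difference is nonnegative on [U] and vanishes at [y], where [x] is farthest. *)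
have : \forall z \near y, (F \- bregmanr x) y <= (F \- bregmanr x) z.
  apply: filterS (int_dom_nbhs Uy) => z Uz /=.
  rewrite (left_farthest_distrE Uy yx) subrr subr_ge0.
  exact: bregmanr_le_farthest yx.1.
move=> /(grad_min dFB) gFB.
(* The direction [y - x] turns this derivative into the quadratic form of the Hessian at [y - x]. *)
have /eqP : 'd (bregmanr x) y (y - x) = 0.
  have := dot_grad (F \- bregmanr x) y (y - x).
  rewrite gFB dot0l (diffB dFy dB) /= -(dot_grad F) gF dot0l sub0r.
  by move=> /eqP; rewrite eq_sym oppr_eq0 => /eqP.
rewrite BE => /eqP H0; exists y; apply: farthest_self => //.
suff {2}-> : y = x by [].
apply/eqP; rewrite -subr_eq0; apply/negPn/negP => yx0.
by have := pH y (mem_set Uy) _ yx0; rewrite H0 ltxx.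
Qed.

Lemma singleton_farthest_grad c y : C = [set c] -> U y ->
  differentiable (egrad f) y -> differentiable F y /\
  grad F y = (y - Q y) *m hessian (fine \o f) y.
Proof.
move=> CE Uy dG; have [dB BE] := bregmanr_diff c Uy dG.
have FB : \forall z \near y, F z = bregmanr c z.
  apply: filterS (int_dom_nbhs Uy) => z Uz; apply: left_farthest_distrE => //.
  by rewrite (singleton_left_farthest_map CE Uz).
have [dF ->] := near_eq_differentiable FB dB; split => //.
apply: dot_inj => v; rewrite dot_grad BE (singleton_left_farthest_pt CE Uy).
(* Differentiation puts the Hessian on the direction [v]; symmetry moves it to [y - c]. *)
apply: hessian_sym => //.
by apply: filterS (int_dom_nbhs Uy) => z; exact: Legendre_differentiable.
Qed.

End left_bregman.

Theorem theorem6p5 (R : realType) (J : nat) (f : 'rV[R]_J -> \bar R)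
    (C : set 'rV[R]_J) (fL : convex_Legendre f) (f1 : one_coercive f)
    (C0 : C !=set0) (Cb : bounded_set C) (Cc : closed C)
    (CU : C `<=` int_dom f) :
  let U := int_dom f in
  let F := left_farthest_distr f C in
  let Q := left_farthest_pt f C in
  let gradfs := egrad (conjugate f) in
  [/\ [<-> (* (i) *) left_Klee f C;
           (* (ii) *) left_Klee f C /\ {within U, continuous Q};
           (* (iii) *) continuously_differentiable_on setT (F \o gradfs);
           (* (iv) *) econvex (neg_reflect_on f C);
           (* (v) *) exists c, C = [set c]],
      left_Klee f C ->
        forall s, grad (F \o gradfs) s = gradfs s - Q (gradfs s) &
      twice_continuously_differentiable_on U (fine \o f) ->
      {in U, forall y, positive_definite (hessian (fine \o f) y)} ->
        [<-> (* (i) *) left_Klee f C;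
             (* (ii) *) left_Klee f C /\ {within U, continuous Q};
             (* (iii) *) continuously_differentiable_on setT (F \o gradfs);
             (* (iv) *) econvex (neg_reflect_on f C);
             (* (v) *) exists c, C = [set c];
             (* (vi) *) {in U, forall y, differentiable F y}] /\
        ({in U, forall y, differentiable F y} ->
           continuously_differentiable_on U F /\
           {in U, forall y,
              grad F y = (y - Q y) *m hessian (fine \o f) y})].
Proof.
move=> U F Q gradfs.
have gsU : forall s, U (gradfs s) by exact: egrad_conjugate_int.
have gsK : cancel gradfs (egrad f) by exact: egrad_conjugateK.
have egK y : U y -> gradfs (egrad f y) = y by exact: egradK.
have gs_cont : continuous gradfs by move=> s; have [] := conjugate_egrad fL f1 s.
clearbody gradfs.
have QE c y : C = [set c] -> U y -> Q y = c by exact: singleton_left_farthest_pt.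
have K5 c : C = [set c] -> left_Klee f C.
  by move=> CE y Uy; exists c; exact: singleton_left_farthest_map.
have KD s : left_Klee f C ->
    differentiable (F \o gradfs) s /\ grad (F \o gradfs) s = gradfs s - Q (gradfs s).
  exact: Klee_differentiable.
have DC : (forall s, differentiable (F \o gradfs) s) -> exists c, C = [set c].
  exact: differentiable_singleton.
(* Continuity is read off (v): [Q] is constant on [U] once [C] is a singleton. *)
have K2 : left_Klee f C -> left_Klee f C /\ {within U, continuous Q}.
  move=> kl; split=> //; have [c CE] := DC (fun s => (KD s kl).1).
  apply: (@subspace_eq_continuous _ _ _ (cst c)).
    by move=> y /set_mem Uy; rewrite /from_subspace/= (QE c).
  by apply: continuous_subspaceT; exact: cst_continuous.
have K23 : left_Klee f C -> continuously_differentiable_on setT (F \o gradfs).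
  exact: Klee_continuously_differentiable.
(* Differentiability already collapses [C] to a point, so (iv) is also reached through (v). *)
have K34 : continuously_differentiable_on setT (F \o gradfs) ->
    econvex (neg_reflect_on f C).
  move=> [dF _]; have [|c CE] := DC; first by move=> s; apply: dF; rewrite inE.
  exact: singleton_econvex CE.
have K45 : econvex (neg_reflect_on f C) -> exists c, C = [set c].
  exact: econvex_singleton.
split.
- tfae=> //; first by move=> [/K23].
  by move=> [c /K5].
- by move=> kl s; have [] := KD s kl.
move=> [_ dG cH] pH.
have {}dG y : U y -> differentiable (egrad f) y by move=> Uy; apply: dG; rewrite inE.
have K6 : {in U, forall y, differentiable F y} -> exists c, C = [set c].
  by move=> dF; apply: (differentiable_farthest_singleton fL C0 Cb Cc CU gsU gsK egK).
have gF c y : C = [set c] -> U y -> differentiable F y /\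
    grad F y = (y - Q y) *m hessian (fine \o f) y.
  by move=> CE Uy; apply: (singleton_farthest_grad fL C0 Cb Cc CU CE Uy (dG _ Uy)).
split.
- tfae=> //; first by move=> [/K23].
  + by move=> [c CE] y /set_mem Uy; have [] := gF c y CE Uy.
  + by move=> /K6[c /K5].
move=> /K6[c CE]; split; last first.
  by move=> y /set_mem Uy; have [] := gF c y CE Uy.
split; first by move=> y /set_mem Uy; have [] := gF c y CE Uy.
(* With [Q] replaced by its constant value [c], the gradient formula is continuous as soon as the
   Hessian is. *)
pose G (y : 'rV[R]_J) : 'rV[R]_J := (y - c) *m hessian (fine \o f) y.
apply: (@subspace_eq_continuous _ _ _ G).
  move=> y /set_mem Uy; rewrite /from_subspace/=; have [_ ->] := gF c y CE Uy.
  by rewrite (QE c).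
have oU : open U by exact: open_interior.
rewrite continuous_open_subspace// in cH.
apply: continuous_in_subspaceT => y yU.
apply: (@cvg_mulmx _ _ (nbhs y) _ 1 J J (fun y => y - c)); last exact: cH.
by apply: (@cvgB _ _ _ (nbhs y) _ id (cst c)); [exact: cvg_id|exact: cvg_cst].
Qed.
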